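(* Let $n\ge 1$ be an integer and let $f_1,\dots,f_n\in L^1[0,1]$. Then there exists $\sigma\in D_n$ such that $\langle f_i,\sigma\rangle=0$ for all $i=1,\dots,n$.
   Context: All functions are real-valued. For $f\in L^1[0,1]$ and $\sigma\in L^\infty[0,1]$, $\langle f,\sigma\rangle=\int_0^1\sigma(t)f(t)\,dt$. Let $\Delta^n=\{\mathbf x=(x_1,\dots,x_n)\in\mathbb R^n\mid 0\le x_1\le x_2\le\dots\le x_n\le 1\}$, and put $x_0=0$, $x_{n+1}=1$. For $\mathbf x\in\Delta^n$, $\Sigma_n(\mathbf x)\in L^\infty[0,1]$ is the class of the function with $\Sigma_n(\mathbf x)(t)=(-1)^m$ for $x_m\le t<x_{m+1}$ ($0\le m\le n$) and $\Sigma_n(\mathbf x)(1)=(-1)^n$. Let $D_n=\Sigma_n(\Delta^n)\subset L^\infty[0,1]$. *)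

(* Defs.v *)
From HB Require Import structures.
From mathcomp Require Import all_boot all_order all_algebra.
From mathcomp Require Import all_classical all_reals all_analysis
  measurable_realfun ess_sup_inf.

Set Implicit Arguments.
Unset Strict Implicit.
Unset Printing Implicit Defensive.

Import Order.TTheory GRing.Theory Num.Theory.
Import numFieldNormedType.Exports.

Local Open Scope classical_set_scope.
Local Open Scope ring_scope.

(* The library has the quotient type [LspaceType] but not the map from
   [LfunType] to it that sends a function to its almost-everywhere class. *)
Section Lclass.
Context d (T : measurableType d) (R : realType).
Variable mu : {measure set T -> \bar R}.

Lemma ae_eq_Lnorm (p : \bar R) (f g : T -> R) :
  measurable_fun setT f -> measurable_fun setT g ->
  f = g %[ae mu] -> ('N[mu]_p[EFin \o f] = 'N[mu]_p[EFin \o g])%E.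
Proof.
move=> mf mg fg; have afg : \forall x \ae mu, `|(f x)%:E|%E = `|(g x)%:E|%E.
  by apply: filterS fg => x /(_ I) ->.
rewrite unlock; case: p => [r||]; last 2 first.
- by rewrite (eq_ess_sup afg).
- by rewrite (eq_ess_inf afg).
have mP (h : T -> R) : measurable_fun setT h ->
    measurable_fun setT (((@poweR R)^~ r \o abse) \o (EFin \o h)).
  move=> mh; apply: measurableT_comp; last exact/measurable_EFinP.
  by apply: measurableT_comp => //; exact: measurable_poweR.
congr (_ `^ _)%E; apply: ae_eq_integral => //; [exact: mP|exact: mP|].
by apply: filterS afg => x fgx _; exact: (congr1 ((@poweR R)^~ r) fgx).
Qed.

Variables (p : \bar R) (p1 : (1 <= p)%E) (f : LfunType mu p1).

(* [f] again, with the codomain that [LspaceType] requires. *)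
Definition Lfun_toR : T -> measurableTypeR R := f.

Let measurable_Lfun_toR : measurable_fun setT Lfun_toR.
Proof. exact: (measurable_funPT (f : {mfun T >-> R})). Qed.

HB.instance Definition _ :=
  isMeasurableFun.Build _ _ T (measurableTypeR R) Lfun_toR measurable_Lfun_toR.

Definition aeclass : {mfun_ mu, T >-> measurableTypeR R} :=
  \pi_({mfun_ mu, T >-> measurableTypeR R})%qT
    (Lfun_toR : {mfun T >-> measurableTypeR R}).

Lemma aeclassE : (aeclass : T -> R) = f %[ae mu].
Proof.
have := reprK aeclass => /eqquotP /asboolP; exact.
Qed.

Let finite_norm_aeclass : finite_norm mu p aeclass.
Proof.
rewrite /finite_norm (ae_eq_Lnorm p _ _ aeclassE).
- exact: Lfunction_finite.
- exact: (measurable_funPT (repr aeclass)).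
- exact: (measurable_funPT (f : {mfun T >-> R})).
Qed.

HB.instance Definition _ := isFinLebesgue.Build d T R mu p p1 aeclass
  finite_norm_aeclass.

Definition Lclass : LspaceType mu p1 := aeclass.

End Lclass.

Section UnitInterval.
Variable R : realType.

(* Classes modulo [mu01]-a.e. equality of functions on the line are the same
   as classes of functions on [0, 1]. *)
Definition mu01 : {measure set (measurableTypeR R) -> \bar R} :=
  mrestr (@lebesgue_measure R) (measurable_itv `[0, 1]).

Definition L1_01 := LspaceType mu01 (lexx 1%E).
Definition Linfty_01 := LspaceType mu01 (leey 1%E).

(* The product of an L^1 and an L^infty function is integrable, and the
   integral does not depend on the representatives [f] and [sigma] coerce to. *)
Definition pairing (f : L1_01) (sigma : Linfty_01) : R :=
  \int[lebesgue_measure]_(t in `[0, 1]) (sigma t * f t).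

Variable n : nat.

(* The entries of [x] are x_1, ..., x_n at positions 0, ..., n-1;
   [knot x m] is x_m, with x_0 = 0 and x_(n+1) = 1. *)
Definition knot (x : 'rV[R]_n) (m : nat) : R :=
  if m is k.+1 then oapp (x ord0) 1 (insub k) else 0.
Arguments knot : simpl never.

Definition Delta : set 'rV[R]_n :=
  [set x | forall m, (m <= n)%N -> knot x m <= knot x m.+1].

(* Total in [x] and [t]; lemmas [stepE] and [step1] below give its values on
   [0, 1] for [x] in [Delta]. *)
Definition step (x : 'rV[R]_n) : measurableTypeR R -> R := fun t =>
  \sum_(m < n.+1) (-1) ^+ m * \1_(`[knot x m, knot x m.+1[) t
  + (-1) ^+ n * \1_[set 1] t.

Lemma measurable_step x :
  measurable_fun setT (step x).
Proof.
apply: measurable_funD.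
  by apply: measurable_sum => m; apply: measurable_funM.
by apply: measurable_funM.
Qed.

HB.instance Definition _ x :=
  isMeasurableFun.Build _ _ (measurableTypeR R) R (step x) (measurable_step x).

Lemma finite_norm_step x : finite_norm mu01 +oo%E (step x).
Proof.
rewrite /finite_norm unlock; case: ifP => _; last by rewrite ltry.
apply: (@le_lt_trans _ _ (n.+2%:R : R)%:E); last by rewrite ltry.
apply/ess_supP; apply: nearW => t; rewrite /= lee_fin.
have le1 k (A : set R) : `|(-1) ^+ k * \1_A t| <= 1 :> R.
  by rewrite normrM normrX normrN1 expr1n mul1r indicE; case: (_ \in _);
     rewrite ?normr1 ?normr0.
rewrite (le_trans (ler_normD _ _))// -[n.+2]addn1 natrD lerD//.
rewrite (le_trans (ler_norm_sum _ _ _))//.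
rewrite (le_trans (ler_sum _ (fun i _ => le1 _ _)))//.
by rewrite sumr_const card_ord.
Qed.

HB.instance Definition _ x :=
  isLfunction.Build _ (measurableTypeR R) R mu01 +oo%E (leey 1%E) (step x) (finite_norm_step x).

Definition Sigma (x : 'rV[R]_n) : Linfty_01 :=
  Lclass (step x : LfunType mu01 (leey 1%E)).

Lemma SigmaE x : (Sigma x : R -> R) = step x %[ae mu01].
Proof. exact: aeclassE. Qed.

Definition DSigma : set Linfty_01 := Sigma @` Delta.

Lemma knot0 x : knot x 0 = 0. Proof. by []. Qed.

Lemma knotS x (i : 'I_n) : knot x i.+1 = x ord0 i.
Proof. by rewrite /knot valK. Qed.

Lemma knot_last x : knot x n.+1 = 1.
Proof. by rewrite /knot insubF ?ltnn. Qed.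

Lemma knot_le x i j : Delta x -> (i <= j <= n.+1)%N -> knot x i <= knot x j.
Proof.
move=> Dx; elim: j => [|j IH] /andP[]; first by rewrite leqn0 => /eqP ->.
rewrite leq_eqVlt ltnS => /orP[/eqP -> //|ij jn].
by rewrite (le_trans (IH _)) ?Dx// ij ltnW.
Qed.

Lemma stepE x m t : Delta x -> (m <= n)%N ->
  knot x m <= t < knot x m.+1 -> step x t = (-1) ^+ m.
Proof.
move=> Dx mn /andP[lt tr]; have mn' : (m < n.+1)%N by [].
have t1 : t < 1.
  by rewrite (lt_le_trans tr)// -(knot_last x) knot_le// ltnS mn/=.
rewrite /step indicE memNset ?mulr0 ?addr0; last by move=> /= e; rewrite e ltxx in t1.
rewrite (bigD1 (Ordinal mn'))//= big1 ?addr0 => [|i].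
  by rewrite indicE mem_set ?mulr1//= in_itv/= lt tr.
rewrite -val_eqE/= neq_ltn => /orP[im|mi];
    rewrite indicE memNset ?mulr0//= in_itv/= => /andP[].
- move=> _; apply/negP; rewrite -leNgt (le_trans _ lt)// knot_le//.
  by rewrite im/= ltnW// ltnS.
- move=> + _; apply/negP; rewrite -ltNge (lt_le_trans tr)// knot_le//.
  by rewrite mi/= ltnW.
Qed.

Lemma step1 x : Delta x -> step x 1 = (-1) ^+ n.
Proof.
move=> Dx; rewrite /step indicE mem_set// mulr1 big1 ?add0r// => i _.
rewrite indicE memNset ?mulr0//= in_itv/= => /andP[_]; apply/negP.
by rewrite -leNgt -[leRHS](knot_last x) knot_le// ltnS leqnn andbT -ltnS.
Qed.

End UnitInterval.

Arguments Delta R n : clear implicits.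
Arguments DSigma R n : clear implicits.

(* Main.v *)
Require Import Defs.
From mathcomp Require Import all_boot all_order fingroup perm all_algebra.
From mathcomp Require Import all_classical all_reals all_analysis measurable_realfun.
From mathcomp Require Import zify ring lra.

(** The signs may be found from the primitives F_i of the f_i alone: integrating
    f_i against the step function with switches x_1, ..., x_n gives the sum over
    m of (-1)^m (F_i(x_{m+1}) - F_i(x_m)) (lemma [pairing_alt_sum]), and all
    that matters about the F_i is that they are uniformly continuous.  The set
    of all x is compact and these sums are continuous in x, so it is enough to
    make them all arbitrarily small ([exact_solution]).

    For this, cut [0, 1] into N equal parts and let the colours i = 0, ..., n-1
    take turns in moving along their primitives.  The result is a necklace of
    N n beads, each of one colour and with a small real weight, and what is
    wanted is a sign for every bead, with at most n changes of sign along the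
    necklace, that nearly balances every colour ([necklace_splitting],
    [approx_solution]).  This is necklace splitting between two thieves.

    The splitting comes from the combinatorial form of the Borsuk-Ulam theorem on
    the cross-polytope, [octahedral_tucker]: an antipodal labelling of the
    nonzero vectors of {+, -, 0}^J by signed numbers, such that comparable
    vectors never get opposite labels, uses at least J absolute values.  Let y be
    such a vector and give bead j the sign x_j = (-1)^j y_j, or no sign yet when
    y_j = 0.  If some side already holds clearly more than half of the weight of
    some colour, label y by that colour and side; this can never be reversed by
    a larger vector.  Otherwise label it by the number of sign changes of y,
    which also behaves well under extension.  As y can be completed greedily to
    a balanced distribution, and the twist by (-1)^j exchanges changes and
    non-changes, the absence of a balanced distribution with at most n changes
    would bound the changes of y by J - n - 2; with the n colours that makes at
    most J - 1 absolute values, a contradiction.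

    Tucker's lemma itself follows by Ky Fan's parity argument: the number of
    maximal chains of vectors supported on d coordinates whose labels, in order
    of absolute value, alternate in sign starting with + has the same parity for
    all d ([parityS]), and it is 1 for d = 0. *)

Set Implicit Arguments.
Unset Strict Implicit.
Unset Printing Implicit Defensive.

Import Order.TTheory GRing.Theory Num.Theory.
Import numFieldNormedType.Exports.

(** * Alternating sign sequences and parity *)

(** In each orbit {x, h x} exactly one element precedes its image in the
    enumeration of T, so comparing ranks splits the sum into two equal halves. *)
Lemma addb_big_involution (T : finType) (P : pred T) (h : T -> T)
    (F : T -> bool) :
    (forall x, P x -> [/\ P (h x), h (h x) = x, h x != x & F (h x) = F x]) ->
  \big[addb/false]_(x | P x) F x = false.
Proof.
move=> hP; rewrite (bigID (fun x => enum_rank x < enum_rank (h x))) /=.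
rewrite [X in _ (+) X](reindex_onto h h) => [|x /andP[/hP[]//]].
rewrite [X in _ (+) X](eq_big (fun x => P x && (enum_rank x < enum_rank (h x))) F).
- by rewrite addbb.
- move=> x; apply/idP/idP.
    move=> /andP[/andP[Phx]] + /eqP hhx.
    have [Px _ hx _] := hP _ Phx; rewrite hhx in Px hx *.
    rewrite Px -leqNgt leq_eqVlt => /orP[/eqP|//].
    by move=> /val_inj /enum_rank_inj xE; rewrite -xE eqxx in hx.
  by move=> /andP[Px xhx]; have [-> -> _ _] := hP _ Px; rewrite eqxx -leqNgt ltnW.
- by move=> x /andP[/andP[Phx _] /eqP hhx]; have [_ _ _] := hP _ Phx; rewrite hhx.
Qed.

Fixpoint alternates (b : bool) (s : seq bool) : bool :=
  if s is c :: s' then (c == b) && alternates (~~ b) s' else true.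

Definition del T k (s : seq T) := take k s ++ drop k.+1 s.

Lemma map_del T S (g : T -> S) k s : map g (del k s) = del k (map g s).
Proof. by rewrite /del map_cat map_take map_drop. Qed.

(** An alternating sequence keeps alternating only if an end is deleted, and which
    end is determined by the required first sign; a sequence that is not
    alternating can be made so only by deleting either entry of its one repeated
    pair, hence in zero or two ways. *)
Lemma alternates_del b s :
  \big[addb/false]_(k < size s) alternates b (del k s)
    = alternates b s (+) alternates (~~ b) s.
Proof.
elim: s b => [|c s IH] b; first by rewrite big_ord0.
rewrite /= big_ord_recl /= {1}/del take0 cat0s drop1 /=.
rewrite (eq_bigr (fun k : 'I_(size s) => (c == b) && alternates (~~ b) (del k s)))//.
rewrite -big_distrr /= IH negbK.
by case: b c => [] [] /=; case: (alternates true s); case: (alternates false s).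
Qed.

(** A signed number is coded by a natural number whose half is its absolute value
    and whose parity is its sign. *)
Definition sortalt b (s : seq nat) := alternates b [seq odd x | x <- sort leq s].

Lemma perm_sortalt b s t : perm_eq s t -> sortalt b s = sortalt b t.
Proof.
move=> st; rewrite /sortalt; congr (alternates b (map odd _)); apply/perm_sortP => //.
- exact: leq_total.
- exact: leq_trans.
- exact: anti_leq.
Qed.

Lemma big_del_rem b s :
  \big[addb/false]_(k < size s) sortalt b (del k s)
    = \big[addb/false]_(x <- s) sortalt b (rem x s).
Proof.
rewrite (big_nth 0) big_mkord; apply: eq_bigr => k _; apply: perm_sortalt.
rewrite -(perm_cons (nth 0 s k)) -(permPr (perm_to_rem (mem_nth 0 (ltn_ord k)))).
rewrite -[X in perm_eq _ X](cat_take_drop k) (drop_nth 0 (ltn_ord k)).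
by rewrite /del -[_ :: (_ ++ _)]/([:: nth 0 s k] ++ _) perm_catCA.
Qed.

Lemma perm_rem (T : eqType) (x : T) s t : perm_eq s t -> perm_eq (rem x s) (rem x t).
Proof.
move=> st; have xst := perm_mem st x; case: (boolP (x \in s)) => [xs|xs].
  by rewrite -(perm_cons x) -(permPl (perm_to_rem xs)) -(permPr (perm_to_rem _)) -?xst.
by rewrite !rem_id// -xst.
Qed.

(** [alternates_del] does not depend on the order of the sequence, since deleting
    an entry and sorting commute. *)
Lemma sortalt_del b s :
  \big[addb/false]_(k < size s) sortalt b (del k s)
    = sortalt b s (+) sortalt (~~ b) s.
Proof.
have ss : perm_eq (sort leq s) s by rewrite perm_sort.
transitivity (\big[addb/false]_(k < size (sort leq s)) sortalt b (del k (sort leq s))).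
  rewrite !big_del_rem (perm_big _ ss); apply: eq_bigr => x _.
  apply: perm_sortalt; apply: perm_rem; by rewrite perm_sym.
rewrite (eq_bigr (fun k : 'I__ => alternates b (del k [seq odd x | x <- sort leq s]))).
  by rewrite -(size_map odd) alternates_del.
move=> k _; rewrite /sortalt sorted_sort ?map_del//; first exact: leq_trans.
apply: (subseq_sorted leq_trans) (sort_sorted leq_total s).
rewrite /del -[X in subseq _ X](cat_take_drop k); apply: cat_subseq => //.
by rewrite -[in X in subseq X _]add1n -drop_drop drop_subseq.
Qed.

(** * Tucker's lemma on the cross-polytope *)

Section Tucker.
Variable N : nat.

Definition signvec := {ffun 'I_N -> option bool}.
Definition sv0 : signvec := [ffun=> None].
Definition sv_opp (x : signvec) : signvec := [ffun i => omap negb (x i)].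
Definition sv_le (x y : signvec) := forall i, x i != None -> y i = x i.

Variable lab : signvec -> nat * bool.

Definition code (l : nat * bool) := l.1.*2 + l.2.

(** A maximal chain of nonzero sign vectors is a signed permutation: coordinate i
    enters at step [c.1 i] with sign [c.2 i], and [cell c k] is the vector reached
    after k steps. *)
Definition flag : finType := ({perm 'I_N} * {ffun 'I_N -> bool})%type.

Definition cell (c : flag) k : signvec :=
  [ffun i => if c.1 i < k then Some (c.2 i) else None].

(** The signed permutations of the first d coordinates, extended in the standard
    way to all N of them so that every dimension uses the same type. *)
Definition in_dim d (c : flag) :=
  [forall i : 'I_N, (d <= i) ==> (c.1 i == i) && c.2 i].

Definition labels (c : flag) d := [seq code (lab (cell c k.+1)) | k <- iota 0 d].

Definition parity d := \big[addb/false]_(c | in_dim d c) sortalt true (labels c d).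

Lemma in_dimP d (c : flag) :
  reflect (forall i : 'I_N, d <= i -> c.1 i = i /\ c.2 i) (in_dim d c).
Proof.
apply: (iffP forallP) => [H i di|H i].
  by have := H i; rewrite di => /andP[/eqP].
by apply/implyP => /H[-> ->]; rewrite eqxx.
Qed.

Lemma in_dim_lt d (c : flag) (i : 'I_N) : in_dim d c -> (c.1 i < d) = (i < d).
Proof.
move=> /in_dimP cd; case: (ltnP i d) => [id|di]; last by have [-> _] := cd _ di; lia.
rewrite ltnNge; apply/negP => dci; have [/perm_inj ci _] := cd _ dci.
by rewrite ci leqNgt id in dci.
Qed.

Lemma parity0 : parity 0.
Proof.
rewrite /parity (big_pred1 ((1%g, [ffun=> true]) : flag))//.
move=> [p s]; apply/in_dimP/eqP => [H|[-> ->] i _]; last by rewrite perm1 ffunE.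
by congr pair; [apply/permP => i|apply/ffunP => i]; have [] := H i isT;
  rewrite ?perm1 ?ffunE.
Qed.

Lemma labels_del_eq c c' k d : k < d ->
  (forall j, j < d -> j != k -> cell c j.+1 = cell c' j.+1) ->
  del k (labels c d) = del k (labels c' d).
Proof.
move=> kd H; rewrite /labels -!map_del; apply/eq_in_map => j; rewrite mem_cat.
rewrite take_iota drop_iota !mem_iota => jk; rewrite H//; lia.
Qed.

Definition flag_swap (k l : 'I_N) (c : flag) : flag := ((c.1 * tperm k l)%g, c.2).

Definition flag_flip (k : 'I_N) (c : flag) : flag :=
  (c.1, [ffun i => c.2 i (+) (c.1 i == k)]).

(** Apart from its top, a member of a maximal chain can be exchanged in exactly one
    way: the two coordinates entering just before and just after it trade
    places. *)
Lemma swap_cancel e k (kN : k < N) (k1N : k.+1 < N) (o : 'I_N) : k < e -> o = e :> nat ->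
  \big[addb/false]_(c | in_dim e.+1 c && c.2 o)
    sortalt true (del k (labels c e.+1)) = false.
Proof.
move=> ke oe.
apply: (@addb_big_involution _ _ (flag_swap (Ordinal kN) (Ordinal k1N))) => c.
move=> /andP[/in_dimP cP co]; split.
- rewrite co andbT; apply/in_dimP => i ei /=; have [ci ->] := cP i ei.
  rewrite permM ci tpermD//; apply/eqP => /(congr1 val) /=; lia.
- by rewrite /flag_swap/= -mulgA tperm2 mulg1; case: (c).
- apply/eqP => /(congr1 fst) /=; rewrite -[RHS]mulg1 => /mulgI.
  move=> /(congr1 (fun p : 'S_N => p (Ordinal kN))).
  by rewrite tpermL perm1 => /(congr1 val) /=; lia.
- congr sortalt; apply: labels_del_eq; first lia.
  move=> j je jk; apply/ffunP => i; rewrite !ffunE /= permM.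
  by case: tpermP => [->|->|//] /=; rewrite ?ltnS; case: ifP; case: ifP => //; lia.
Qed.

(** The top of a maximal chain can be exchanged only by reversing the sign of the
    coordinate that enters last; this stays in the half-sphere where o is
    positive as long as that coordinate is not o. *)
Lemma flip_cancel e (o : 'I_N) : o = e :> nat ->
  \big[addb/false]_(c | (in_dim e.+1 c && c.2 o) && (c.1 o != o))
    sortalt true (del e (labels c e.+1)) = false.
Proof.
move=> oe; apply: (@addb_big_involution _ _ (flag_flip o)) => c.
move=> /andP[/andP[/in_dimP cP co] coo]; split.
- rewrite coo andbT /= ffunE (negbTE coo) co andbT.
  apply/in_dimP => i ei /=; rewrite ffunE; have [-> ->] := cP i ei.
  by split => //; apply/eqP => /(congr1 val) /=; lia.
- by rewrite [LHS]surjective_pairing [RHS]surjective_pairing /=; congr pair;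
    apply/ffunP => i; rewrite !ffunE addbK.
- apply/eqP => /(congr1 (fun f : flag => f.2 ((c.1^-1)%g o))) /=.
  by rewrite ffunE permKV eqxx addbT; case: (c.2 _).
- congr sortalt; apply: labels_del_eq => // j je jk; apply/ffunP => i.
  rewrite !ffunE /=; case: ifP => // cij; congr Some.
  case: eqP => [cio|]; last by rewrite addbF.
  by move: cij; rewrite cio oe; lia.
Qed.

Hypothesis lab_opp : forall x, x != sv0 ->
  lab (sv_opp x) = ((lab x).1, ~~ (lab x).2).
Hypothesis lab_noncompl : forall x y, x != sv0 -> sv_le x y ->
  (lab x).1 = (lab y).1 -> (lab x).2 = (lab y).2.

Definition flag_opp d (c : flag) : flag :=
  (c.1, [ffun i => c.2 i (+) (i < d)]).

Lemma cell_opp d k c : in_dim d c -> k <= d ->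
  cell (flag_opp d c) k = sv_opp (cell c k).
Proof.
move=> cd kd; apply/ffunP => i; rewrite !ffunE /=; case: ifP => //= ik.
by rewrite -(in_dim_lt _ cd) (leq_trans ik)// addbT.
Qed.

Lemma cell_neq0 c k : k < N -> cell c k.+1 != sv0.
Proof.
move=> kN; apply/eqP => /ffunP /(_ ((c.1^-1)%g (Ordinal kN))).
by rewrite !ffunE permKV /= ltnSn.
Qed.

Lemma cell_le c k l : k <= l -> sv_le (cell c k) (cell c l).
Proof. by move=> kl i; rewrite !ffunE; case: ifP => // ik _; rewrite (leq_trans ik). Qed.

Definition flipbit (a : nat) := a./2.*2 + ~~ odd a.

Lemma half_code l : (code l)./2 = l.1.
Proof. by rewrite /code addnC half_bit_double. Qed.

Lemma odd_code l : odd (code l) = l.2.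
Proof. by rewrite /code oddD odd_double; case: l.2. Qed.

Lemma flipbitE l : flipbit (code l) = code (l.1, ~~ l.2).
Proof. by rewrite /flipbit half_code odd_code. Qed.

Lemma labels_opp d c : d <= N -> in_dim d c ->
  labels (flag_opp d c) d = map flipbit (labels c d).
Proof.
move=> dN cd; rewrite /labels -map_comp; apply/eq_in_map => k.
rewrite mem_iota /= => kd; rewrite cell_opp// lab_opp ?flipbitE//.
by apply: cell_neq0; lia.
Qed.

Lemma labels_noncompl d c a b : d <= N -> a \in labels c d -> b \in labels c d ->
  a./2 = b./2 -> a = b.
Proof.
move=> dN /mapP[k + ->] /mapP[l + ->]; rewrite !mem_iota !half_code => /= kd ld kl.
rewrite /code kl; congr (_ + nat_of_bool _).
case: (leqP k l) => [kl'|/ltnW lk].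
  by apply: lab_noncompl => //; [apply: cell_neq0; lia|exact: cell_le].
by apply/esym; apply: lab_noncompl => //; [apply: cell_neq0; lia|exact: cell_le].
Qed.

(** Without opposite labels in s, changing all signs leaves the order by absolute
    value intact. *)
Lemma sortalt_flip b s : (forall x y, x \in s -> y \in s -> x./2 = y./2 -> x = y) ->
  sortalt b (map flipbit s) = sortalt (~~ b) s.
Proof.
move=> Hs; rewrite /sortalt.
have -> : sort leq (map flipbit s) = map flipbit (sort leq s).
  apply: (@sorted_eq _ leq leq_trans anti_leq); first exact: sort_sorted leq_total _.
    apply: (homo_sorted_in (e := leq) (P := mem s)) (sort_sorted leq_total s).
      move=> x y xs ys xy; rewrite /flipbit.
      case: (eqVneq x./2 y./2) => [/(Hs _ _ xs ys)->//|].
      by move: xy; lia.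
    by apply/allP => x; rewrite mem_sort.
  by rewrite perm_sort perm_sym perm_map// perm_sort.
rewrite -map_comp; elim: (sort leq s) b => //= x t IH b; rewrite IH; congr (_ && _).
by rewrite /flipbit oddD odd_double /=; case: (odd x) b => [] [].
Qed.

(** Count, on the half-sphere where the coordinate o of rank e is positive, the
    pairs of a maximal chain and a member whose removal leaves labels alternating
    from +.  Chain by chain this gives the chains whose labels alternate from +
    or from -; the latter are the antipodes of chains alternating from + on the
    other half-sphere, so that the total is [parity e.+1].  Facet by facet, all
    cancels except for the facets on the boundary sphere, which give
    [parity e]. *)
Lemma parityS e : e < N -> parity e.+1 = parity e.
Proof.
move=> eN; pose o := Ordinal eN.
transitivity (\big[addb/false]_(c | in_dim e.+1 c && c.2 o)
   \big[addb/false]_(k < e.+1) sortalt true (del k (labels c e.+1))).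
  rewrite [RHS](eq_bigr (fun c => sortalt true (labels c e.+1)
     (+) sortalt true (labels (flag_opp e.+1 c) e.+1))); last first.
    move=> c /andP[cP co]; have := sortalt_del true (labels c e.+1).
    rewrite size_map size_iota => ->; congr addb.
    rewrite labels_opp// sortalt_flip// => x y; exact: labels_noncompl.
  rewrite big_split /= /parity (bigID (fun c : flag => c.2 o)) /=; congr addb.
  have oppK c : flag_opp e.+1 (flag_opp e.+1 c) = c.
    by rewrite [LHS]surjective_pairing [RHS]surjective_pairing /=; congr pair;
      apply/ffunP => i; rewrite !ffunE addbK.
  rewrite (reindex_onto (flag_opp e.+1) (flag_opp e.+1)) => [|c _]; last exact: oppK.
  apply: eq_bigl => c; rewrite oppK eqxx andbT /= ffunE ltnSn addbT negbK.
  congr andb; apply/in_dimP/in_dimP => cP i ei; have := cP i ei;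
    by rewrite /= ffunE ltnNge ei addbF.
rewrite exchange_big big_ord_recr /= big1 ?addFb => [|k _]; last first.
  have ke := ltn_ord k; by apply: (@swap_cancel _ _ _ _ o) => //; lia.
rewrite (bigID (fun c : flag => c.1 o == o)) /= flip_cancel// addbF.
apply: eq_big => c.
  apply/idP/in_dimP => [/andP[/andP[/in_dimP cP co] /eqP coo] i|cP].
    rewrite leq_eqVlt => /orP[/eqP ei|]; last exact: cP.
    by have -> : i = o by apply/val_inj.
  have [-> ->] := cP o (leqnn _); rewrite eqxx !andbT; apply/in_dimP => i ei.
  by apply: cP; lia.
move=> _; rewrite /labels -map_del /del take_iota drop_iota /minn ltnSn.
by rewrite subnn cats0.
Qed.

(** Along the sorted alternating labels no code repeats, and equal absolute values
    would force equal codes. *)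
Lemma sortalt_size m b s : (forall x y, x \in s -> y \in s -> x./2 = y./2 -> x = y) ->
  (forall x, x \in s -> x./2 < m) -> sortalt b s -> size s <= m.
Proof.
move=> Hs sm alt; suff us : uniq (map half s).
  rewrite -(size_map half) -(size_iota 0 m); apply: uniq_leq_size => // _ /mapP[x xs ->].
  by rewrite mem_iota add0n sm.
rewrite map_inj_in_uniq//; suff : uniq (sort leq s) by rewrite sort_uniq.
apply: (sorted_uniq ltn_trans ltnn).
move: alt (sort_sorted leq_total s); rewrite /sortalt.
case: (sort leq s) => //= x t /andP[/eqP <-].
elim: t x => //= y t IH x /andP[/eqP oy]; rewrite -oy => alt /andP[xy pt].
rewrite (IH y alt pt) andbT ltn_neqAle xy andbT.
by apply/eqP => xy'; move: oy; rewrite xy'; case: odd.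
Qed.

Theorem octahedral_tucker m : (forall x, x != sv0 -> (lab x).1 < m) -> N <= m.
Proof.
move=> lab_m; have parity1 d : d <= N -> parity d.
  by elim: d => [|d IH] dN; [exact: parity0|rewrite parityS// IH// ltnW].
have [c cP alt] : exists2 c, in_dim N c & sortalt true (labels c N).
  apply/exists_inP; apply: contraT; rewrite negb_exists_in => /forall_inP H.
  by have := parity1 _ (leqnn N); rewrite /parity big1// => c /H /negbTE.
rewrite -(size_iota 0 N) -(size_map (fun k => code (lab (cell c k.+1)))).
apply: (sortalt_size _ _ alt) => [x y|_ /mapP[k + ->]].
  exact: labels_noncompl.
by rewrite mem_iota half_code => kN; apply: lab_m; apply: cell_neq0; lia.
Qed.

End Tucker.

(** * Sign changes of partial sign vectors *)

(** The unset entries are skipped, and the first set entry is compared with b.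
    For a vector with at least one sign the two choices of b give its number of
    sign changes and that number plus one, the smaller for b its first sign. *)
Fixpoint switches (b : bool) (s : seq (option bool)) : nat :=
  match s with
  | [::] => 0
  | None :: s' => switches b s'
  | Some c :: s' => (b != c) + switches c s'
  end.

Lemma switches_negb b s : switches (~~ b) s <= (switches b s).+1.
Proof. by elim: s => //= -[[]|] s IH //; case: b {IH} => /=; lia. Qed.

Lemma switches_neq s : has isSome s -> switches true s != switches false s.
Proof. by elim: s => //= -[[]|] s IH //= _; lia. Qed.

Lemma switches_opp b s : switches b (map (omap negb) s) = switches (~~ b) s.
Proof. by elim: s b => //= -[c|] s IH b //=; rewrite IH negbK; case: b c => [] []. Qed.

Lemma switches_mono (T : Type) (f g : T -> option bool) b e :
  (forall i, f i != None -> g i = f i) ->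
  switches b (map f e) <= switches b (map g e).
Proof.
move=> fg; elim: e b => //= i e IH b.
case fi : (f i) => [c|]; first by rewrite fg fi// leq_add2l.
case: (g i) => [c|] //; apply: (leq_trans (IH b)).
by have := switches_negb c (map g e); case: b c => [] [] /=; lia.
Qed.

(** Between neighbours, the sign changes either in x or in x twisted by the parity
    of the position, but never in both. *)
Lemma switches_twist (T : Type) (x : T -> bool) (p : T -> nat) b k e :
  map p e = iota k (size e) ->
  switches b (map (fun i => Some (x i)) e)
  + switches (b (+) ~~ odd k) (map (fun i => Some (x i (+) odd (p i))) e) = size e.
Proof.
elim: e b k => //= i e IH b k [pik /IH IHk] /=.
rewrite -(IHk (x i)) /= negbK pik.
by case: b (x i) (odd k) => [] [] [] /=; lia.
Qed.

(** * Necklace splitting for two thieves *)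

Local Open Scope ring_scope.

Section Necklace.
Variables (R : realFieldType) (J n : nat).
Variables (col : 'I_J -> 'I_n) (c : 'I_J -> R) (eps : R).
Hypotheses (eps_ge0 : 0 <= eps) (c_le : forall j, `|c j| <= eps).

(* For the sign x_j = y_j (+) odd j of bead j, the contribution (-1)^(x_j) c_j is
   (-1)^(y_j (+) h j) times the absolute value of c_j. *)
Let h (j : 'I_J) := odd j (+) (c j < 0).

Definition side i b (y : signvec J) : R :=
  \sum_(j | (col j == i) && (y j == Some (b (+) h j))) `|c j|.

Definition total i : R := \sum_(j | col j == i) `|c j|.

(** The slack eps leaves room for the greedy completion of
    [extend_no_majority]. *)
Definition majority i b y := total i / 2 + eps < side i b y.

Lemma side_opp i b y : side i b (sv_opp y) = side i (~~ b) y.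
Proof.
apply: eq_bigl => j; rewrite ffunE; congr andb.
by case: (y j) => [[]|] //=; case: b (h j) => [] [].
Qed.

Lemma side_le i b y y' : sv_le y y' -> side i b y <= side i b y'.
Proof.
move=> yy'; rewrite /side big_mkcond [leRHS]big_mkcond; apply: ler_sum => j _.
case: ifP => [/andP[-> /eqP yj]|_]; first by rewrite yy' yj// eqxx.
by case: ifP.
Qed.

Lemma side_total i y :
  total i = side i true y + side i false y
            + \sum_(j | (col j == i) && (y j == None)) `|c j|.
Proof.
rewrite /total /side big_mkcond [X in X + _ + _]big_mkcond.
rewrite [X in _ + X + _]big_mkcond [X in _ + X]big_mkcond -!big_split.
apply: eq_bigr => j _ /=; case: (col j == i) => /=; last by rewrite !addr0.
by case: (y j) => [a|] /=; case: (h j); rewrite ?addr0 ?add0r//;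
  case: a; rewrite ?addr0 ?add0r.
Qed.

Lemma side_total_le i y : side i true y + side i false y <= total i.
Proof. by rewrite (side_total i y) lerDl sumr_ge0. Qed.

Lemma side_set i b (y : signvec J) j v : y j = None ->
  side i b [ffun k => if k == j then Some v else y k]
    = side i b y + (if (col j == i) && (v == b (+) h j) then `|c j| else 0).
Proof.
move=> yj; rewrite /side big_mkcond [in RHS]big_mkcond (bigD1 j)//= [in RHS](bigD1 j)//=.
rewrite ffunE eqxx yj andbF add0r addrC; congr (_ + _).
by apply: eq_bigr => k /negbTE kj; rewrite ffunE kj.
Qed.

Let lighter_side_bound (t s0 s1 v r : R) : s0 <= s1 -> v <= eps -> 0 <= r ->
  t = s1 + s0 + (v + r) -> s0 + v <= t / 2 + eps.
Proof. by have := eps_ge0; move=> *; lra. Qed.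

(** Each bead goes to the side that holds less of its colour: that side then has
    at most half of the total plus half of the bead. *)
Lemma extend_no_majority (y : signvec J) : (forall i b, ~~ majority i b y) ->
  exists y', [/\ sv_le y y', forall j, y' j != None & forall i b, ~~ majority i b y'].
Proof.
have [m] := ubnP #|[pred j | y j == None]|; elim: m y => // m IH y ym yP.
have [/forallP yN|] := boolP [forall j, y j != None]; first by exists y.
rewrite negb_forall => /existsP[j]; rewrite negbK => /eqP yj.
pose b := side (col j) true y > side (col j) false y.
pose b' := ~~ b.
pose z : signvec J := [ffun k => if k == j then Some (b' (+) h j) else y k].
have yz : sv_le y z by move=> k; rewrite ffunE; case: (eqVneq k j) => // ->; rewrite yj.
have [|i a|y' [zy' y'N y'P]] := IH z.
- apply: (@leq_trans #|[pred j | y j == None]|); last by rewrite -ltnS.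
  apply: proper_card; apply/properP; split.
    by apply/fintype.subsetP => k; rewrite !inE ffunE; case: (eqVneq k j).
  by exists j; rewrite !inE ?yj// ffunE eqxx.
- rewrite /majority side_set//; have := yP i a; rewrite /majority.
  case: (eqVneq (col j) i) => [<-|_]; last by rewrite addr0.
  case: (eqVneq (b' (+) h j) (a (+) h j)) => [/addIb ba _|_]; last by rewrite addr0.
  have := side_total (col j) y; rewrite (bigD1 j) ?eqxx ?yj//=.
  set rest := \sum_(_ | _) _; have : 0 <= rest by exact: sumr_ge0.
  have := c_le j; rewrite -leNgt -ba /b' /b; case: ltP => /= [/ltW|] le01 cj rest0 tE.
    exact: lighter_side_bound le01 cj rest0 tE.
  by apply: lighter_side_bound le01 cj rest0 _; rewrite tE [side _ true y + _]addrC.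
- by exists y'; split => // k yk; rewrite zy' yz.
Qed.

Let enumJ := enum 'I_J.

Definition untwist (y : signvec J) (j : 'I_J) := odflt false (y j) (+) odd j.

Lemma balanced_full (y : signvec J) i : (forall j, y j != None) ->
  (forall b, ~~ majority i b y) ->
  `|\sum_(j | col j == i) (-1) ^+ untwist y j * c j| <= 2 * eps.
Proof.
move=> yN yP.
have -> : \sum_(j | col j == i) (-1) ^+ untwist y j * c j
    = side i false y - side i true y.
  rewrite /side big_mkcond [X in X - _]big_mkcond [X in _ - X]big_mkcond -sumrB.
  apply: eq_bigr => j _; case: (col j == i) => /=; last by rewrite subr0.
  have := yN j; rewrite /untwist /h; case: (y j) => // a _ /=.
  by case: ltP => cj; [rewrite ltr0_norm//|rewrite ger0_norm//];
    case: a (odd j) => [] [] /=; rewrite ?expr0 ?expr1; ring.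
have := side_total i y; rewrite big_pred0 => [|j]; last by rewrite (negbTE (yN j)) andbF.
have := yP true; have := yP false; rewrite /majority -!leNgt ler_norml; lra.
Qed.

Definition nswitch (y : signvec J) :=
  minn (switches true (map y enumJ)) (switches false (map y enumJ)).

(** The number of sign changes is shifted by n to keep clear of the colours; its
    sign is the first sign of y. *)
Definition nlabel (y : signvec J) : nat * bool :=
  if [pick i | majority i true y || majority i false y] is Some i
  then (val i, majority i true y)
  else ((n + nswitch y)%N,
        (switches true (map y enumJ) < switches false (map y enumJ))%N).

Lemma sv_switches_le (y z : signvec J) b : sv_le y z ->
  (switches b (map y enumJ) <= switches b (map z enumJ))%N.
Proof. exact: switches_mono. Qed.

Lemma sv_has (y : signvec J) : y != sv0 J -> has isSome (map y enumJ).
Proof.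
apply: contraNT; rewrite has_map -all_predC => /allP yN; apply/eqP/ffunP => j.
by rewrite ffunE; have := yN j (mem_enum _ _) => /=; case: (y j).
Qed.

(** Otherwise [nlabel] would contradict Tucker's lemma with J - 1 absolute
    values. *)
Theorem necklace_splitting : exists2 x : 'I_J -> bool,
  (exists b, (switches b [seq Some (x j) | j <- enumJ] <= n)%N) &
  forall i, `|\sum_(j | col j == i) (-1) ^+ x j * c j| <= 2 * eps.
Proof.
have [[y]|bad] := pselect (exists y : signvec J, [/\ forall j, y j != None,
    forall i b, ~~ majority i b y &
    exists b, (switches b [seq Some (untwist y j) | j <- enumJ] <= n)%N]).
  by case=> yN yP sy; exists (untwist y) => // i; exact: balanced_full.
(* A balanced y untwists to more than n sign changes; [switches_twist] turns this
   into few sign changes of y itself. *)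
have full_bad (y : signvec J) b : (forall j, y j != None) ->
    (forall i b, ~~ majority i b y) ->
    (switches b (map y enumJ) + n < J)%N.
  move=> yN yP; rewrite ltnNge; apply/negP => yb; apply: bad; exists y; split => //.
  exists (~~ b); have := @switches_twist _ (untwist y) val (~~ b) 0 enumJ.
  rewrite val_enum_ord size_enum_ord => /(_ erefl).
  have -> : [seq Some (untwist y j (+) odd (val j)) | j <- enumJ] = map y enumJ.
    by apply: eq_map => j; rewrite /untwist addbK; have := yN j; case: (y j).
  by rewrite /= addbT negbK => JE; move: yb; rewrite -[X in (X <= _)%N]JE addnC leq_add2l.
have no_maj_switches (y : signvec J) : y != sv0 J -> (forall i b, ~~ majority i b y) ->
    (n + nswitch y < J.-1)%N.
  move=> y0 yP; have [y' [yy' y'N y'P]] := extend_no_majority yP.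
  have := full_bad _ true y'N y'P; have := full_bad _ false y'N y'P.
  have := sv_switches_le true yy'; have := sv_switches_le false yy'.
  by have := switches_neq (sv_has y0); rewrite /nswitch; lia.
have maj_excl i y : majority i true y -> majority i false y -> False.
  have e0 := eps_ge0; have := side_total_le i y; rewrite /majority => ? ? ?; lra.
have [y0 [_ y0N y0P]] : exists y', [/\ sv_le (sv0 J) y', forall j, y' j != None
    & forall i b, ~~ majority i b y'].
  apply: extend_no_majority => i b; rewrite /majority /side big1 => [|j].
    by rewrite -leNgt addr_ge0// divr_ge0// sumr_ge0.
  by rewrite ffunE andbF.
have J_gt : (n < J)%N by have := full_bad _ true y0N y0P; lia.
suff : (J <= J.-1)%N by lia.
have pick_none y : [pick i | majority i true y || majority i false y] = None ->
    forall i b, ~~ majority i b y.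
  case: pickP => // H _ i b; have := H i.
  by case: b; case: majority => //=; case: majority.
apply: (@octahedral_tucker _ nlabel) => [y ynz|y z ynz yz|y ynz]; rewrite /nlabel.
- have majN i b : majority i b (sv_opp y) = majority i (~~ b) y.
    by rewrite /majority side_opp.
  rewrite (@eq_pick _ _ (fun i => majority i true y || majority i false y)); last first.
    by move=> i; rewrite /= !majN orbC.
  case: pickP => [i /orP iP|_] /=.
    rewrite majN /=; congr pair; move: iP (@maj_excl i y).
    by case: (majority i true y); case: (majority i false y) => [] // [] // _
      /(_ isT isT).
  have mapN : map (sv_opp y) enumJ = map (omap negb) (map y enumJ).
    by elim: enumJ => //= j s ->; rewrite ffunE.
  rewrite /nswitch mapN !switches_opp /= minnC; congr pair.
  by have := switches_neq (sv_has ynz); case: ltngtP.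
- have majS i b : majority i b y -> majority i b z.
    by move=> /lt_le_trans; apply; exact: side_le.
  case: pickP => [i iP|yN]; case: pickP => [k kP|zN] /=.
  + move=> /val_inj ik; rewrite -{}ik in kP *.
    case/orP: iP => /[dup] iy /majS iz.
      by rewrite iy iz.
    rewrite (negbTE (introN idP (fun it => maj_excl _ _ it iz))).
    by rewrite (negbTE (introN idP (fun it => maj_excl _ _ it iy))).
  + by move=> /(congr1 (leq n)); rewrite leq_addr leqNgt ltn_ord.
  + by move=> /(congr1 (leq n)); rewrite leq_addr leqNgt ltn_ord.
  + have := sv_switches_le true yz; have := sv_switches_le false yz.
    have := switches_neq (sv_has ynz); rewrite /nswitch.
    move: (switches_negb true (map y enumJ)) (switches_negb false (map y enumJ)).
    move: (switches_negb true (map z enumJ)) (switches_negb false (map z enumJ)) => /=.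
    lia.
- case pickE : [pick _ | _] => [i|]; first by apply: leq_trans (ltn_ord i) _; lia.
  exact: no_maj_switches (pick_none _ pickE).
Qed.
End Necklace.

(** * From beads to continuous functions *)

(** Up to a global sign, x is (-1)^m on the m-th of n + 1 consecutive blocks; fewer
    than n switches are made up for by empty blocks. *)
Lemma cut_points (R : pzRingType) (x : seq bool) b n k :
  (switches b (map Some x) <= n)%N ->
  exists a : nat -> nat, [/\ a 0 = k, a n.+1 = (k + size x)%N,
    forall m, (m <= n)%N -> (a m <= a m.+1)%N &
    forall w : nat -> R, \sum_(k <= j < k + size x) (-1) ^+ nth false x (j - k) * w j
      = (-1) ^+ b * \sum_(m < n.+1) (-1) ^+ m * \sum_(a m <= j < a m.+1) w j].
Proof.
elim: x b n k => [|c x IH] b n k /=.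
  move=> _; exists (fun=> k); split; rewrite ?addn0// => w.
  rewrite big_geq// big1 ?mulr0// => m _; by rewrite big_geq ?mulr0.
have same n' : (switches c (map Some x) <= n')%N ->
  exists a : nat -> nat, [/\ a 0 = k, a n'.+1 = (k + (size x).+1)%N,
    forall m, (m <= n')%N -> (a m <= a m.+1)%N &
    forall w : nat -> R,
    \sum_(k <= j < k + (size x).+1) (-1) ^+ nth false (c :: x) (j - k) * w j
      = (-1) ^+ c * \sum_(m < n'.+1) (-1) ^+ m * \sum_(a m <= j < a m.+1) w j].
  move=> /(IH _ _ k.+1)[a [a0 an ale aw]].
  have a1 : (k < a 1%N)%N by rewrite -a0 ale.
  exists (fun m => if m is 0%N then k else a m); split => //.
  - by rewrite an addnS addSn.
  - by move=> [_|m] /=; [exact: ltnW|exact: ale].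
  - move=> w; rewrite big_ltn ?leq_addr ?addnS ?ltnS ?leq_addr// subnn /=.
    rewrite -addSn big_nat_cond.
    under eq_bigr => j /andP[/andP[kj _] _] do
      rewrite -[(j - k)%N]prednK ?subn_gt0//= -subnS.
    rewrite -big_nat_cond aw !big_ord_recl /= a0 (big_ltn a1) !mul1r.
    by rewrite -mulrDr -addrA.
case: (eqVneq b c) => [->|bc] /=; first exact: same.
case: n => // n; rewrite add1n ltnS => /same[a [a0 an ale aw]].
exists (fun m => if m is m'.+1 then a m' else k); split => //.
- by move=> [_|m] /=; [rewrite a0|exact: ale].
- move=> w; rewrite aw [in RHS]big_ord_recl /= a0 big_geq// mulr0 add0r.
  have -> : (-1) ^+ b = - (-1) ^+ c :> R.
    by move: bc; case: (b); case: (c) => //= _; rewrite ?expr1 ?expr0 ?opprK.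
  rewrite mulNr -mulrN -sumrN; congr (_ * _); apply: eq_bigr => m _.
  by rewrite /bump /= add1n add0n exprS mulN1r mulNr opprK.
Qed.

Lemma residue_eq n i j : (i < n)%N -> (n %| (j + i).+1)%N -> i = (n.-1 - j %% n)%N.
Proof.
move=> lt_in /dvdnP[q jq]; have n_gt0 : (0 < n)%N by lia.
have := divn_eq j n; have := ltn_pmod j n_gt0.
move: (j %/ n)%N (j %% n)%N => u r rn ju.
have uq : (u < q)%N by rewrite -(ltn_pmul2r n_gt0); lia.
have qu : (q < u.+2)%N by rewrite -(ltn_pmul2r n_gt0) !mulSn; lia.
have qE : q = u.+1 by lia.
by move: jq; rewrite qE mulSn; lia.
Qed.

Section Approx.
Variables (R : realType) (n : nat) (F : 'I_n -> R -> R).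

Definition alt_sum (x : 'rV[R]_n) (i : 'I_n) : R :=
  \sum_(m < n.+1) (-1) ^+ m * (F i (knot x m.+1) - F i (knot x m)).

(** Let colour i stand at the point ((a + i) %/ n) / N after a steps: exactly one
    colour moves in each step, by 1 / N, and all colours stay within 1 / N of the
    common point (a %/ n) / N.  Splitting the necklace of these moves and
    replacing each colour's position at the cuts by the common point costs two
    errors of eps for each of the n + 1 blocks, besides the 2 eps of the
    splitting. *)
Lemma approx_solution (N : nat) (eps : R) : (0 < n)%N -> (0 < N)%N -> 0 <= eps ->
  (forall i s t, `|s - t| <= N%:R^-1 -> `|F i s - F i t| <= eps) ->
  exists2 x : 'rV[R]_n, Delta R n x & forall i, `|alt_sum x i| <= (2 * n.+2)%:R * eps.
Proof.
move=> n_gt0 N0 eps0 Feps.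
pose J := (N * n)%N.
pose t k : R := k%:R / N%:R.
pose G i a := F i (t ((a + i) %/ n)%N).
have tS k l : (k <= l <= k.+1)%N -> `|t l - t k| <= N%:R^-1.
  move=> /andP[kl lk]; rewrite /t -mulrBl normrM.
  rewrite (ger0_norm (_ : 0 <= N%:R^-1)) ?invr_ge0//.
  by rewrite -[leRHS]mul1r ler_wpM2r ?invr_ge0// -natrB// normr_nat (ler_nat _ _ 1); lia.
have colP (j : 'I_J) : (n.-1 - j %% n < n)%N by lia.
pose col j := Ordinal (colP j).
have divS (i : 'I_n) j : (((j + i) %/ n) <= ((j.+1 + i) %/ n) <= ((j + i) %/ n).+1)%N.
  by rewrite addSn divnS//; case: dvdn; rewrite !leqnSn ?leqnn.
have Gcol (i : 'I_n) (j : 'I_J) : i != col j -> G i j.+1 = G i j.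
  move=> ij; rewrite /G; congr (F i (t _)).
  rewrite addSn divnS//; case: (boolP (n %| _)%N) => // /(residue_eq (ltn_ord i)) iE.
  by case/eqP: ij; apply/val_inj.
pose c j := G (col j) j.+1 - G (col j) j.
have [j|x [b xn] xbal] := @necklace_splitting R J n col c eps eps0.
  exact/Feps/tS/divS.
have xn' : (switches b (map Some (codom x)) <= n)%N by rewrite -map_comp.
have [a [a0 an ale aw]] := @cut_points R (codom x) b n 0 xn'.
pose y : 'rV[R]_n := \row_i t (a i.+1 %/ n)%N.
have yE m : (m <= n.+1)%N -> knot y m = t (a m %/ n)%N.
  case: m => [|m]; first by rewrite a0 div0n /t mul0r.
  rewrite ltnS leq_eqVlt => /orP[/eqP ->|mn].
    by rewrite knot_last an size_codom card_ord /J mulnK// /t divff// pnatr_eq0 -lt0n.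
  by rewrite (knotS y (Ordinal mn)) mxE.
exists y => [m mn|i].
  rewrite !yE ?ltnS//; last exact: leqW.
  by rewrite /t ler_wpM2r ?invr_ge0// ler_nat leq_div2r// ale.
have GE : `|\sum_(m < n.+1) (-1) ^+ m * (G i (a m.+1) - G i (a m))| <= 2 * eps.
  rewrite (le_trans _ (xbal i))//.
  have -> : \sum_(j | col j == i) (-1) ^+ x j * c j
      = (-1) ^+ b * \sum_(m < n.+1) (-1) ^+ m * (G i (a m.+1) - G i (a m)).
    have tel (m : 'I_n.+1) : G i (a m.+1) - G i (a m)
        = \sum_(a m <= j < a m.+1) (G i j.+1 - G i j).
      by rewrite telescope_sumr// ale// -ltnS.
    rewrite (eq_bigr _ (fun m _ => congr1 (fun z => (-1) ^+ val m * z) (tel m))).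
    rewrite -aw size_codom card_ord add0n big_mkord big_mkcond; apply: eq_bigr => j _.
    rewrite subn0 (nth_map j) ?size_enum_ord// nth_ord_enum.
    case: eqVneq => [<-//|ji]; last by rewrite Gcol ?subrr ?mulr0// eq_sym.
  by rewrite normrM normrX normrN1 expr1n mul1r.
have -> : alt_sum y i = \sum_(m < n.+1) (-1) ^+ m * (G i (a m.+1) - G i (a m))
   + \sum_(m < n.+1) (-1) ^+ m * ((F i (t (a m.+1 %/ n)%N) - G i (a m.+1))
                                 - (F i (t (a m %/ n)%N) - G i (a m))).
  rewrite -big_split; apply: eq_bigr => m _; rewrite [RHS]/= -mulrDr; congr (_ * _).
  rewrite yE ?[knot y m]yE//; last exact: ltnW.
  ring.
have FG k : `|F i (t (k %/ n)%N) - G i k| <= eps.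
  rewrite distrC; apply/Feps/tS; rewrite leq_div2r ?leq_addr//=.
  apply: (leq_trans (leq_div2r n (leq_add (leqnn k) (ltnW (ltn_ord i))))).
  by rewrite divnDr ?dvdnn// divnn n_gt0 addn1.
rewrite (le_trans (ler_normD _ _))// mulnSr natrD mulrDl addrC lerD//.
rewrite (le_trans (ler_norm_sum _ _ _))//.
have : forall m : 'I_n.+1, true -> `|(-1) ^+ m * ((F i (t (a m.+1 %/ n)%N) - G i (a m.+1))
                                 - (F i (t (a m %/ n)%N) - G i (a m)))| <= 2 * eps.
  move=> m _; rewrite normrM normrX normrN1 expr1n mul1r (le_trans (ler_normB _ _))//.
  by rewrite mulr_natl mulr2n lerD.
move=> /ler_sum /le_trans; apply; rewrite sumr_const card_ord -[leLHS]mulr_natl.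
by rewrite natrM mulrA [_%:R * 2]mulrC.
Qed.
End Approx.

(** * Compactness *)

Local Open Scope classical_set_scope.
Local Open Scope ring_scope.

Section Compactness.
Variables (R : realType) (n : nat).

Lemma continuous_knot m : continuous (fun x : 'rV[R]_n => knot x m).
Proof.
rewrite /knot; case: m => [|m] x; first exact: cst_continuous.
case: (insub m : option 'I_n) => [i|] /=; first exact: coord_continuous.
exact: cst_continuous.
Qed.

Lemma compact_Delta : compact (Delta R n).
Proof.
have cube := @rV_compact R n (fun=> `[0, 1]%classic) (fun=> @segment_compact R 0 1).
apply: (subclosed_compact _ cube) => [|x Dx i]; last first.
  rewrite /= in_itv /= -knotS -{1}(knot0 x) -(knot_last x).
  by rewrite !knot_le//=; have := ltn_ord i; lia.
have -> : Delta R n = \bigcap_(m in [set m | (m <= n)%N])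
    ((fun x : 'rV[R]_n => knot x m.+1 - knot x m) @^-1` [set y | 0 <= y]).
  apply/seteqP; split => x Dx m mn /=; first by rewrite subr_ge0 Dx.
  by rewrite -subr_ge0; exact: (Dx m mn).
apply: closed_bigI => m _; apply: preimage_closed => [x _|]; last exact: closed_ge.
exact: (cvgB (@continuous_knot m.+1 x) (@continuous_knot m x)).
Qed.

Variable F : 'I_n -> R -> R.
Hypothesis F_unif : forall i (e : R), 0 < e ->
  exists2 d : R, 0 < d & forall s t, `|s - t| < d -> `|F i s - F i t| <= e.

Lemma F_continuous i : continuous (F i).
Proof.
move=> t; apply/cvgrPdist_le => e /(F_unif i)[d d0 Fd].
by exists d => //= s; exact: Fd.
Qed.

(** The sum of the absolute values of the n alternating sums maps the compact set
    [Delta] onto a closed set, which comes arbitrarily close to 0. *)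
Lemma exact_solution : (0 < n)%N ->
  exists2 x : 'rV[R]_n, Delta R n x & forall i, alt_sum F x i = 0.
Proof.
move=> n_gt0; pose Phi (x : 'rV[R]_n) : R := \sum_i `|alt_sum F x i|.
have cPhi : continuous Phi.
  apply: (continuous_big (@add_continuous _)) => i _ x.
  apply: (continuous_comp (f := alt_sum F ^~ i)); last exact: norm_continuous.
  apply: (continuous_big (@add_continuous _)) => m _ {}x.
  have Fk k : continuous_at x (fun y : 'rV[R]_n => F i (knot y k)).
    by apply: continuous_comp; [exact: continuous_knot|exact: F_continuous].
  exact: (cvgM (cvg_cst _) (cvgB (Fk m.+1) (Fk m))).
suff [x Dx Px] : (Phi @` Delta R n) 0.
  exists x => // i; apply/eqP; rewrite -normr_eq0; move/eqP: Px.
  by rewrite psumr_eq0// => /allP /(_ i (mem_index_enum i)).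
have : closed (Phi @` Delta R n).
  apply: compact_closed; first exact: Rhausdorff.
  apply: continuous_compact compact_Delta.
  exact: continuous_subspaceT.
apply; move=> B [e /= e0 Be].
have k_gt0 : 0 < (n * (2 * n.+2))%:R + 1 :> R by rewrite ltr_wpDl.
pose eps := e / ((n * (2 * n.+2))%:R + 1).
have eps0 : 0 < eps by rewrite divr_gt0.
have : \forall N \near \oo, forall i s t,
    `|s - t| <= N.+1%:R^-1 -> `|F i s - F i t| <= eps.
  apply: filter_forall => i; have [d d0 Fd] := F_unif i eps0.
  apply: filterS (near_infty_natSinv_lt (PosNum d0)) => N /= Nd s t st.
  by apply: Fd; exact: le_lt_trans Nd.
move=> /filter_ex[N HN].
have [x Dx xP] := approx_solution n_gt0 (ltn0Sn N) (ltW eps0) HN.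
exists (Phi x); split; first by exists x.
apply: Be; rewrite /= sub0r normrN ger0_norm ?sumr_ge0//.
apply: (@le_lt_trans _ _ (\sum_(i < n) (2 * n.+2)%:R * eps)); first exact: ler_sum.
rewrite sumr_const card_ord -[_ *+ _]mulr_natl mulrA -natrM /eps mulrA ltr_pdivrMr//.
by rewrite mulrC ltr_pM2l// ltrDl.
Qed.

End Compactness.

(** * The pairing as an alternating sum of primitives *)

Section Pairing.
Variable R : realType.
Notation mu := (@lebesgue_measure R).
Local Notation D := (`[0%R, 1%R]%classic : set (measurableTypeR R)).

Lemma mu01_sub A : A `<=` D -> mu01 R A = mu A.
Proof. by move=> AD; rewrite /mu01/= /mrestr setIidl. Qed.

Lemma integrable_mu01 (f : measurableTypeR R -> R) :
  (mu01 R).-integrable setT (EFin \o f) -> mu.-integrable D (EFin \o f).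
Proof.
move=> fT; have mD : measurable D by exact: measurable_itv.
have /integrableP[mf fi] := integrableS (@measurableT _ (measurableTypeR R)) mD
  (@subsetT _ D) fT.
apply/integrableP; split => //.
apply: le_lt_trans fi; rewrite le_eqVlt; apply/orP; left; apply/eqP.
by apply: eq_measure_integral => A _ /mu01_sub.
Qed.

Lemma measurable_Lspace (p : \bar R) (p1 : (1 <= p)%E) (f : LspaceType (mu01 R) p1) :
  measurable_fun setT (f : measurableTypeR R -> R).
Proof.
have mf := measurable_funPT (generic_quotient.repr
  (f : {mfun_ (mu01 R), measurableTypeR R >-> measurableTypeR R})).
exact: mf.
Qed.

Lemma L1_integrable (f : L1_01 R) : mu.-integrable D (EFin \o f).
Proof.
apply: integrable_mu01; apply/Lfun1_integrable; rewrite inE; apply/andP; split.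
  by rewrite inE; exact: measurable_Lspace.
by rewrite inE; exact: Lebesgue_finite.
Qed.

Lemma pairing_Sigma n (f : L1_01 R) (x : 'rV[R]_n) :
  pairing f (Sigma x) = \int[mu]_(t in D) (step x t * f t).
Proof.
rewrite /pairing /Rintegral; congr fine.
transitivity (\int[mu01 R]_(t in D) (Sigma x t * f t)%:E)%E.
  by apply: eq_measure_integral => A _ /mu01_sub.
transitivity (\int[mu01 R]_(t in D) (step x t * f t)%:E)%E; last first.
  by apply: eq_measure_integral => A _ /mu01_sub.
apply: ae_eq_integral => //.
- apply/measurable_EFinP/measurable_funTS/measurable_funM; exact: measurable_Lspace.
- apply/measurable_EFinP/measurable_funTS/measurable_funM.
    exact: measurable_step.
  exact: measurable_Lspace.
- apply: (@filterS _ _ (ae_filter_ringOfSetsType (mu01 R)) _ _ _ (SigmaE x)).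
  by move=> t tE Dt /=; rewrite tE.
Qed.

Lemma step_bounded n (x : 'rV[R]_n) t : `|step x t| <= n.+2%:R.
Proof.
have le1 k (A : set R) : `|(-1) ^+ k * \1_A t| <= 1 :> R.
  by rewrite normrM normrX normrN1 expr1n mul1r indicE; case: (_ \in _);
    rewrite ?normr1 ?normr0.
rewrite (le_trans (ler_normD _ _))// -[n.+2]addn1 natrD lerD//.
rewrite (le_trans (ler_norm_sum _ _ _))// (le_trans (ler_sum _ (fun i _ => le1 _ _)))//.
by rewrite sumr_const card_ord.
Qed.

(** Integrating from -oo the extension of f by zero makes the primitive uniformly
    continuous on the whole line. *)
Definition primitive (f : R -> R) (t : R) : R := \int[mu]_(u in `]-oo, t]) (f \_ D) u.

Lemma integrable_restrict01 f : mu.-integrable D (EFin \o f) ->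
  mu.-integrable setT (EFin \o (f \_ D)).
Proof.
by move=> fi; rewrite -restrict_EFin; apply/integrable_restrict => //; rewrite setTI.
Qed.

Lemma primitiveB f s t : mu.-integrable D (EFin \o f) -> s <= t ->
  primitive f t - primitive f s = \int[mu]_(u in `]s, t]) (f \_ D) u.
Proof.
move=> /integrable_restrict01 fi st; rewrite /primitive Rintegral_itvB//.
exact: integrableS fi.
Qed.

(** Two values of the primitive differ by an integral over an interval of small
    measure, so this is absolute continuity of the integral. *)
Lemma primitive_unif f e : mu.-integrable D (EFin \o f) -> 0 < e ->
  exists2 d : R, 0 < d & forall s t, `|s - t| < d -> `|primitive f s - primitive f t| <= e.
Proof.
move=> fD e0; have fi := integrable_restrict01 fD.
have [d [d0 dP]] := integral_normr_continuous fi e0.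
have half s t : s <= t -> `|s - t| < d -> `|primitive f s - primitive f t| <= e.
  move=> st std; rewrite distrC primitiveB//.
  apply: le_trans (le_normr_Rintegral _ _) _ => //; first exact: integrableS fi.
  apply/ltW/dP => //.
  rewrite [X in (X < _)%E](lebesgue_measure_itv `]s, t])/= lte_fin; case: ifP => _.
    by rewrite -EFinD lte_fin; move: std; rewrite distrC ger0_norm ?subr_ge0.
  by rewrite lte_fin.
exists d => // s t; case: (leP s t) => [|/ltW] st; first exact: half.
by rewrite distrC [leLHS]distrC; exact: half.
Qed.

(** On each interval between neighbouring knots the step function is the constant
    (-1)^m, so there the primitive H of the product grows by (-1)^m times the
    growth of the primitive of f i. *)
Lemma pairing_alt_sum n (f : 'I_n -> L1_01 R) (x : 'rV[R]_n) i : Delta R n x ->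
  pairing (f i) (Sigma x) = alt_sum (fun i => primitive (f i)) x i.
Proof.
move=> Dx; rewrite pairing_Sigma; set g := fun t => step x t * f i t.
have fi := L1_integrable (f i).
have gi : mu.-integrable D (EFin \o g).
  have -> : EFin \o g = ((EFin \o step x) \* (EFin \o f i))%E by [].
  apply: integrableMr fi; first exact: measurable_itv.
    by apply/measurable_funTS; exact: measurable_step.
  exists n.+2%:R; split => // M nM t _; exact: le_trans (step_bounded x t) (ltW nM).
have knot01 m : (m <= n.+1)%N -> 0 <= knot x m <= 1.
  by move=> mn; rewrite -{1}(knot0 x) -(knot_last x) !knot_le//= ?mn ?leqnn.
pose H t := \int[mu]_(u in `[0, t]) g u.
have sub m : (m <= n)%N -> `]knot x m, knot x m.+1] `<=` D.
  move=> mn u /=; rewrite !in_itv/= => /andP[mu_ um].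
  have /andP[m0 _] := knot01 m (leqW mn); have /andP[_ m1] := knot01 m.+1 mn.
  by rewrite (le_trans m0 (ltW mu_)) (le_trans um).
have HB m : (m <= n)%N -> H (knot x m.+1) - H (knot x m)
    = (-1) ^+ m * (primitive (f i) (knot x m.+1) - primitive (f i) (knot x m)).
  move=> mn; have kk := Dx m mn; rewrite primitiveB// /H Rintegral_itvB//=; last 2 first.
  - apply: integrableS gi => //; apply: subset_itvl; rewrite bnd_simp.
    by case/andP: (knot01 m.+1 mn).
  - by case/andP: (knot01 m (leqW mn)).
  have gi' : mu.-integrable `]knot x m, knot x m.+1] (EFin \o g).
    by apply: integrableS gi => //; exact: sub.
  have oo_oc : `]knot x m, knot x m.+1[ `<=` `]knot x m, knot x m.+1].
    exact: subset_itv_oo_oc.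
  rewrite -Rintegral_itv_bndo_bndc; last exact: integrableS gi'.
  rewrite -[in RHS]Rintegral_itv_bndo_bndc; last first.
    by apply: integrableS (integrable_restrict01 fi).
  rewrite -RintegralZl//; last by apply: integrableS (integrable_restrict01 fi).
  apply: eq_Rintegral => u; rewrite inE => uk; rewrite patchE ifT; last first.
    by rewrite inE; apply/(sub m mn)/oo_oc.
  rewrite /g (stepE Dx mn)//; move: uk; rewrite /= in_itv/= => /andP[/ltW -> ->]//.
transitivity (H (knot x n.+1) - H (knot x 0)).
  by rewrite knot_last knot0 /H set_itv1 Rintegral_set1 subr0.
rewrite -(telescope_sumr (fun m => H (knot x m)) (leq0n n.+1)) big_mkord.
by apply: eq_bigr => m _; apply: HB; rewrite -ltnS.
Qed.
End Pairing.

Unset Implicit Arguments.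

Theorem theorem3p4 (R : realType) (n : nat) (hn : (1 <= n)%N)
    (f : 'I_n -> L1_01 R) :
  exists2 sigma : Linfty_01 R,
    sigma \in DSigma R n & forall i : 'I_n, pairing (f i) sigma = 0.
Proof.
have [x Dx fx0] := exact_solution (fun i e => primitive_unif (L1_integrable (f i))) hn.
exists (Sigma x); first by rewrite inE; exists x.
by move=> i; rewrite pairing_alt_sum.
Qed.
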